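(* Let $A$ and $M$ be the stiffness and mass matrices of the $P_1(\Omega)$ discretization on a triangular mesh, or the $Q_1(\Omega)$ discretization on a quadrilateral mesh, of a polygonal domain $\Omega\subset\mathbb{R}^2$, partitioned into interior and boundary blocks. With the counting functions $N_N,N_D$, multiplicities $m_N,m_D$, inner solution space $\mathcal{S}_{\rm in}(\lambda)$ and reduced Dirichlet-to-Neumann map $\Lambda(\lambda)$ defined in the context, and with $m_{\rm in}(\lambda)=\dim\mathcal{S}_{\rm in}(\lambda)$, for any $\lambda\in\mathbb{R}$ we have $$N_N(\lambda)-N_D(\lambda)=n_-\big(\Lambda(\lambda)\big)+m_D(\lambda)-m_{\rm in}(\lambda)$$ and $$m_N(\lambda)=n_0\big(\Lambda(\lambda)\big)+m_{\rm in}(\lambda),$$ where $n_-(\cdot)$ and $n_0(\cdot)$ denote the number of negative and zero eigenvalues, respectively, counted with multiplicity.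
   Context: Discretization: for each mesh node $\boldsymbol{x}_i$, $\phi_i$ is the corresponding continuous nodal basis function (piecewise linear on triangles, respectively piecewise bilinear on quadrilaterals), with $\phi_i(\boldsymbol{x}_j)=\delta_{i,j}$. Put $a_{i,j}=\int_\Omega\nabla\phi_j\cdot\nabla\phi_i\,dA$ and $m_{i,j}=\int_\Omega\phi_j\phi_i\,dA$; thus $A$ is symmetric positive semidefinite and $M$ is symmetric positive definite. With $n_I$ interior nodes (not on $\partial\Omega$) and $n_B$ boundary nodes (on $\partial\Omega$), ordering interior nodes first, write $$A=\begin{pmatrix} A_{II} & A_{IB} \\ A_{BI} & A_{BB} \end{pmatrix},\qquad M=\begin{pmatrix} M_{II} & M_{IB} \\ M_{BI} & M_{BB} \end{pmatrix}.$$ Eigenvalues: the discrete Neumann problem is $Au=\lambda Mu$ and the discrete Dirichlet problem is $A_{II}u_I=\lambda M_{II}u_I$. Set $m_N(\lambda)=\dim\ker(A-\lambda M)$, $m_D(\lambda)=\dim\ker(A_{II}-\lambda M_{II})$, $N_N(\lambda)=\sum_{s<\lambda}m_N(s)$, $N_D(\lambda)=\sum_{s<\lambda}m_D(s)$. Inner solutions: $\mathcal{S}_{\rm in}(\lambda)=\ker(A_{II}-\lambda M_{II})\cap\ker(A_{BI}-\lambda M_{BI})\subset\mathbb{R}^{n_I}$. Reduced Dirichlet-to-Neumann map: let $P$ be the orthogonal projection in $\mathbb{R}^{n_I}$ onto $\ker(A_{II}-\lambda M_{II})$, and let $$\mathcal{Q}=\ker\big((A_{BI}-\lambda M_{BI})P(A_{IB}-\lambda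 M_{IB})\big)\subseteq\mathbb{R}^{n_B}.$$ Define $$\hat\Lambda(\lambda)=(A_{BB}-\lambda M_{BB})-(A_{BI}-\lambda M_{BI})(A_{II}-\lambda M_{II})^{+}(A_{IB}-\lambda M_{IB}):\mathbb{R}^{n_B}\to\mathbb{R}^{n_B},$$ where $(\cdot)^+$ is the Moore–Penrose pseudoinverse. With $P_{\mathcal{Q}}$ the orthogonal projection onto $\mathcal{Q}$, set $\Lambda(\lambda)=P_{\mathcal{Q}}\hat\Lambda(\lambda)|_{\mathcal{Q}}:\mathcal{Q}\to\mathcal{Q}$. (If $\lambda$ is not a Dirichlet eigenvalue, then $\mathcal{Q}=\mathbb{R}^{n_B}$ and $\Lambda(\lambda)$ is the Schur complement with $(A_{II}-\lambda M_{II})^{-1}$.) *)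

(* Defs.v *)
From HB Require Import structures.
From mathcomp Require Import all_boot all_order all_algebra.
From mathcomp Require Import all_classical all_reals all_analysis.
Set Implicit Arguments.
Unset Strict Implicit.
Unset Printing Implicit Defensive.
Import Order.TTheory GRing.Theory Num.Theory.
Import numFieldNormedType.Exports.
Local Open Scope classical_set_scope.
Local Open Scope ring_scope.

Notation plane R := (R * R)%type.

Definition segment_set (R : realType) (a b : plane R) : set (plane R) :=
  [set z | exists2 t : R, 0 <= t <= 1 & z = (1 - t) *: a + t *: b].

Definition frontier (R : realType) (Omega : set (plane R)) : set (plane R) :=
  closure Omega `\` interior Omega.

Definition polygonal_domain (R : realType) (Omega : set (plane R)) : Prop :=
  [/\ open Omega, connected Omega, Omega !=set0, bounded_set Omega &
      exists s : seq (plane R * plane R),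
        frontier Omega =
        [set z | exists2 e, e \in s & segment_set e.1 e.2 z]].

(* An element with p vertices is given by the cyclic sequence v of its
   vertices; ordS is the cyclic successor.  turn v i is the cross product of
   the two consecutive edges meeting at the vertex v (ordS i). *)
Definition turn (R : realType) (p : nat) (v : 'I_p -> plane R) (i : 'I_p) : R :=
  let e := v (ordS i) - v i in
  let f := v (ordS (ordS i)) - v (ordS i) in
  e.1 * f.2 - e.2 * f.1.

(* For p = 3 and p = 4 this says that v lists counterclockwise the vertices of
   a nondegenerate triangle, resp. of a strictly convex quadrilateral.  Four
   positive turns exclude self-intersection: their angles are in ]0, pi[ and
   add up to a multiple of 2 pi that is less than 4 pi. *)
Definition ccw_polygon (R : realType) (p : nat) (v : 'I_p -> plane R) : Prop :=
  forall i, 0 < turn v i.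

Definition cell (R : realType) (p : nat) (v : 'I_p -> plane R) :
    set (plane R) :=
  [set z | exists w : 'I_p -> R,
     [/\ forall i, 0 <= w i, \sum_i w i = 1 & z = \sum_i w i *: v i]].

Definition edge (R : realType) (p : nat) (v : 'I_p -> plane R) (i : 'I_p) :
    set (plane R) :=
  segment_set (v i) (v (ordS i)).

Definition meet_conformingly (R : realType) (p : nat)
    (v w : 'I_p -> plane R) : Prop :=
  [\/ cell v `&` cell w = set0,
      exists i j, v i = w j /\ cell v `&` cell w = [set v i] |
      exists i j, edge v i = edge w j /\ cell v `&` cell w = edge v i].

Definition conforming_mesh (R : realType) (Omega : set (plane R)) (p m : nat)
    (T : 'I_m -> 'I_p -> plane R) : Prop :=
  [/\ forall k, ccw_polygon (T k),
      closure Omega = \bigcup_k cell (T k) &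
      forall k l, k != l -> meet_conformingly (T k) (T l)].

(* x enumerates without repetition the vertices of the mesh, the nI interior
   ones (lshift) before the nB ones on the boundary (rshift). *)
Definition mesh_nodes (R : realType) (Omega : set (plane R)) (p m : nat)
    (T : 'I_m -> 'I_p -> plane R) (nI nB : nat)
    (x : 'I_(nI + nB) -> plane R) : Prop :=
  [/\ injective x,
      range x = [set z | exists k i, z = T k i],
      forall i, ~ frontier Omega (x (lshift nB i)) &
      forall j, frontier Omega (x (rshift nI j))].

Definition affine_on (R : realType) (K : set (plane R)) (f : plane R -> R) :
    Prop :=
  exists a b c : R, forall z, K z -> f z = a + b * z.1 + c * z.2.

(* The bilinear map from the unit square onto the quadrilateral with vertices
   v 0, ..., v 3. *)
Definition quad_map (R : realType) (v : 'I_4 -> plane R) (s t : R) : plane R :=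
  ((1 - s) * (1 - t)) *: v (inord 0) + (s * (1 - t)) *: v (inord 1)
  + (s * t) *: v (inord 2) + ((1 - s) * t) *: v (inord 3).

(* On a quadrilateral, bilinear means bilinear in the coordinates of the
   reference square, as is usual for Q1 elements; for rectangles with sides
   parallel to the axes this is bilinearity in z.1 and z.2. *)
Definition bilinear_on_quad (R : realType) (v : 'I_4 -> plane R)
    (f : plane R -> R) : Prop :=
  exists a b c d : R, forall s t, 0 <= s <= 1 -> 0 <= t <= 1 ->
    f (quad_map v s t) = a + b * s + c * t + d * (s * t).

Definition continuous_nodal (R : realType) (Omega : set (plane R)) (n : nat)
    (x : 'I_n -> plane R) (phi : 'I_n -> plane R -> R) : Prop :=
  (forall i, {within closure Omega, continuous (phi i)}) /\
  (forall i j, phi i (x j) = (i == j)%:R).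

(* The values of phi i outside of closure Omega are irrelevant. *)
Definition P1_discretization (R : realType) (Omega : set (plane R))
    (nI nB : nat) (x : 'I_(nI + nB) -> plane R)
    (phi : 'I_(nI + nB) -> plane R -> R) : Prop :=
  exists (m : nat) (T : 'I_m -> 'I_3 -> plane R),
    [/\ conforming_mesh Omega T, mesh_nodes Omega T x,
        continuous_nodal Omega x phi &
        forall i k, affine_on (cell (T k)) (phi i)].

Definition Q1_discretization (R : realType) (Omega : set (plane R))
    (nI nB : nat) (x : 'I_(nI + nB) -> plane R)
    (phi : 'I_(nI + nB) -> plane R -> R) : Prop :=
  exists (m : nat) (T : 'I_m -> 'I_4 -> plane R),
    [/\ conforming_mesh Omega T, mesh_nodes Omega T x,
        continuous_nodal Omega x phi &
        forall i k, bilinear_on_quad (T k) (phi i)].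

Notation area R :=
  (product_measure1 (@lebesgue_measure R) (@lebesgue_measure R)).

(* 'D_v f z is a default value where the derivative does not exist; for a
   nodal basis function this happens in Omega only on the edges of the mesh,
   a set of area 0. *)
Definition grad_dot (R : realType) (f g : plane R -> R) (z : plane R) : R :=
  'D_((1, 0) : plane R) f z * 'D_((1, 0) : plane R) g z
  + 'D_((0, 1) : plane R) f z * 'D_((0, 1) : plane R) g z.

Definition stiffness_mx (R : realType) (Omega : set (plane R)) (n : nat)
    (phi : 'I_n -> plane R -> R) : 'M[R]_n :=
  \matrix_(i, j) \int[area R]_(z in Omega) grad_dot (phi j) (phi i) z.

Definition mass_mx (R : realType) (Omega : set (plane R)) (n : nat)
    (phi : 'I_n -> plane R -> R) : 'M[R]_n :=
  \matrix_(i, j) \int[area R]_(z in Omega) (phi j z * phi i z).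

(* MathComp matrices act on row vectors, so a subspace of R^n is represented by
   a matrix whose row space consists of the transposes of its elements.  In
   particular colker X represents the vectors u with X *m u = 0. *)
Definition colker (R : fieldType) (m n : nat) (X : 'M[R]_(m, n)) : 'M[R]_n :=
  kermx X^T.

Lemma colkerP (R : fieldType) (m n : nat) (X : 'M[R]_(m, n)) (u : 'cV[R]_n) :
  reflect (X *m u = 0) (u^T <= colker X)%MS.
Proof.
rewrite /colker; apply: (iffP sub_kermxP) => [h|h].
  by apply: trmx_inj; rewrite trmx_mul h trmx0.
by rewrite -trmx_mul h trmx0.
Qed.

(* Projection onto U along its orthogonal complement, acting on columns. *)
Definition orthoproj (R : fieldType) (m n : nat) (U : 'M[R]_(m, n)) : 'M[R]_n :=
  (proj_mx <<U>>%MS (kermx U^T))^T.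

Lemma mulmx_tr_eq0 (R : realFieldType) (m n : nat) (v : 'M[R]_(m, n)) :
  v *m v^T = 0 -> v = 0.
Proof.
move=> h; apply/matrixP => i j; rewrite mxE.
have /matrixP/(_ i i) := h; rewrite !mxE => /eqP.
rewrite psumr_eq0 => [/allP/(_ j)|k _]; last by rewrite !mxE -expr2 sqr_ge0.
by rewrite mem_index_enum !mxE mulf_eq0 orbb => /(_ isT)/eqP.
Qed.

Lemma orthocompl_cap (R : realFieldType) (m n : nat) (U : 'M[R]_(m, n)) :
  (<<U>> :&: kermx U^T = 0)%MS.
Proof.
set W := (_ :&: _)%MS.
have /submxP[D defW] : (W <= U)%MS by rewrite -(genmxE U) capmxSl.
have WU : W *m U^T = 0 by apply/sub_kermxP; rewrite capmxSr.
by apply: mulmx_tr_eq0; rewrite {2}defW trmx_mul mulmxA WU mul0mx.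
Qed.

Lemma orthocompl_full (R : realFieldType) (m n : nat) (U : 'M[R]_(m, n)) :
  row_full (<<U>> + kermx U^T)%MS.
Proof.
apply/eqP; have := mxrank_sum_cap <<U>>%MS (kermx U^T).
rewrite orthocompl_cap mxrank0 addn0 => ->.
by rewrite mxrank_gen mxrank_ker mxrank_tr subnKC// rank_leq_col.
Qed.

Lemma orthoproj_sub (R : realFieldType) (m n : nat) (U : 'M[R]_(m, n))
    (u : 'cV[R]_n) : ((orthoproj U *m u)^T <= U)%MS.
Proof.
by rewrite trmx_mul trmxK (submx_trans (proj_mx_sub _ _ _))// genmxE.
Qed.

Lemma orthoproj_ortho (R : realFieldType) (m n : nat) (U : 'M[R]_(m, n))
    (u : 'cV[R]_n) : U *m (u - orthoproj U *m u) = 0.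
Proof.
apply: trmx_inj; rewrite trmx0 trmx_mul linearB /= trmx_mul trmxK.
apply/sub_kermxP.
have su : (u^T <= <<U>> + kermx U^T)%MS by rewrite submx_full ?orthocompl_full.
rewrite -{1}(add_proj_mx (orthocompl_cap U) su) addrC addKr.
exact: proj_mx_sub.
Qed.

Definition is_moore_penrose (R : fieldType) (m n : nat)
    (X : 'M[R]_(m, n)) (Y : 'M[R]_(n, m)) : Prop :=
  [/\ X *m Y *m X = X, Y *m X *m Y = Y,
      (X *m Y)^T = X *m Y & (Y *m X)^T = Y *m X].

Definition moore_penrose (R : fieldType) (m n : nat) (X : 'M[R]_(m, n)) :
    'M[R]_(n, m) :=
  xget 0 [set Y | is_moore_penrose X Y].

Lemma row_free_gram (R : realFieldType) (m n : nat) (B : 'M[R]_(m, n)) :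
  row_free B -> B *m B^T \in unitmx.
Proof.
move=> fB; rewrite -row_free_unit -kermx_eq0.
set K := kermx _; have KB : K *m B = 0.
  apply: mulmx_tr_eq0; rewrite trmx_mul mulmxA -(mulmxA K).
  by rewrite mulmx_ker mul0mx.
by apply/eqP; apply: (row_free_inj fB); rewrite mul0mx.
Qed.

Lemma moore_penrose_factor (R : realFieldType) (m r n : nat)
    (C : 'M[R]_(m, r)) (B : 'M[R]_(r, n)) : row_full C -> row_free B ->
  exists Y, is_moore_penrose (C *m B) Y.
Proof.
move=> fC fB; have uB := row_free_gram fB.
have uC : C^T *m C \in unitmx.
  by rewrite -{2}(trmxK C) row_free_gram// /row_free mxrank_tr.
set G := invmx (B *m B^T); set H := invmx (C^T *m C).
have GT : G^T = G by rewrite trmx_inv trmx_mul trmxK.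
have HT : H^T = H by rewrite trmx_inv trmx_mul trmxK.
exists (B^T *m G *m H *m C^T).
have e1 : C *m B *m (B^T *m G *m H *m C^T) = C *m H *m C^T.
  by rewrite !mulmxA -(mulmxA C B) -(mulmxA C _ G) mulmxV// mulmx1.
have e2 : B^T *m G *m H *m C^T *m (C *m B) = B^T *m G *m B.
  by rewrite !mulmxA -(mulmxA _ C^T C) -(mulmxA _ H (C^T *m C)) mulVmx// mulmx1.
split; rewrite ?e1 ?e2.
- by rewrite !mulmxA -(mulmxA _ C^T C) -(mulmxA C H) mulVmx// mulmx1.
- by rewrite !mulmxA -(mulmxA _ B B^T) -(mulmxA _ (B *m B^T) G) mulmxV// mulmx1.
- by rewrite !trmx_mul trmxK HT mulmxA.
- by rewrite !trmx_mul trmxK GT mulmxA.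
Qed.

Lemma moore_penroseP (R : realFieldType) (m n : nat) (X : 'M[R]_(m, n)) :
  is_moore_penrose X (moore_penrose X).
Proof.
apply: (@xgetPex _ 0 [set Y | is_moore_penrose X Y]) => /=.
rewrite -{1}(mulmx_base X).
exact: moore_penrose_factor (col_base_full X) (row_base_free X).
Qed.

Lemma moore_penrose_uniq (R : fieldType) (m n : nat) (X : 'M[R]_(m, n))
    (Y Z : 'M[R]_(n, m)) :
  is_moore_penrose X Y -> is_moore_penrose X Z -> Y = Z.
Proof.
move=> [XYX YXY sXY sYX] [XZX ZXZ sXZ sZX].
have e1 : X *m Y = X *m Z.
  rewrite -[RHS]sXZ -[in RHS]XYX -(mulmxA (X *m Y)) trmx_mul sXZ sXY.
  by rewrite mulmxA XZX.
have e2 : Y *m X = Z *m X.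
  rewrite -[RHS]sZX -[in RHS]XYX -(mulmxA X Y) (mulmxA Z X) trmx_mul sZX sYX.
  by rewrite -mulmxA (mulmxA X Z) XZX.
by rewrite -YXY -mulmxA e1 mulmxA e2 ZXZ.
Qed.

(* Number of negative and of zero eigenvalues, counted with (geometric)
   multiplicity.  A big operator over an infinite set ranges over the indices
   of the nonzero terms, and is 0 if there are infinitely many of them; here and
   in counting (for M positive definite) there are finitely many. *)
Definition n_neg (R : realType) (n : nat) (X : 'M[R]_n) : nat :=
  (\big[addn/0]_(s \in [set s : R | (s < 0)%R]) \rank (eigenspace X s))%N.

Definition n_zero (R : realType) (n : nat) (X : 'M[R]_n) : nat :=
  \rank (eigenspace X 0).

Definition pencil (R : realType) (n : nat) (A M : 'M[R]_n) (lam : R) : 'M[R]_n :=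
  A - lam *: M.

Definition mult (R : realType) (n : nat) (A M : 'M[R]_n) (lam : R) : nat :=
  \rank (colker (pencil A M lam)).

Definition counting (R : realType) (n : nat) (A M : 'M[R]_n) (lam : R) : nat :=
  (\big[addn/0]_(s \in [set s : R | (s < lam)%R]) mult A M s)%N.

Definition m_N (R : realType) (nI nB : nat) (A M : 'M[R]_(nI + nB)) (lam : R) :
    nat := mult A M lam.

Definition N_N (R : realType) (nI nB : nat) (A M : 'M[R]_(nI + nB)) (lam : R) :
    nat := counting A M lam.

Definition m_D (R : realType) (nI nB : nat) (A M : 'M[R]_(nI + nB)) (lam : R) :
    nat := mult (ulsubmx A) (ulsubmx M) lam.

Definition N_D (R : realType) (nI nB : nat) (A M : 'M[R]_(nI + nB)) (lam : R) :
    nat := counting (ulsubmx A) (ulsubmx M) lam.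

Definition S_in (R : realType) (nI nB : nat) (A M : 'M[R]_(nI + nB)) (lam : R) :
    'M[R]_nI :=
  (colker (ulsubmx A - lam *: ulsubmx M) :&:
   colker (dlsubmx A - lam *: dlsubmx M))%MS.

Definition m_in (R : realType) (nI nB : nat) (A M : 'M[R]_(nI + nB)) (lam : R) :
    nat := \rank (S_in A M lam).

Definition Q_space (R : realType) (nI nB : nat) (A M : 'M[R]_(nI + nB))
    (lam : R) : 'M[R]_nB :=
  colker ((dlsubmx A - lam *: dlsubmx M)
          *m orthoproj (colker (ulsubmx A - lam *: ulsubmx M))
          *m (ursubmx A - lam *: ursubmx M)).

Definition DtN_hat (R : realType) (nI nB : nat) (A M : 'M[R]_(nI + nB))
    (lam : R) : 'M[R]_nB :=
  (drsubmx A - lam *: drsubmx M)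
  - (dlsubmx A - lam *: dlsubmx M)
    *m moore_penrose (ulsubmx A - lam *: ulsubmx M)
    *m (ursubmx A - lam *: ursubmx M).

(* The matrix, acting on row vectors of coordinates in the basis row_base Q of
   Q, of the endomorphism u |-> P_Q (DtN_hat u) of Q. *)
Definition DtN (R : realType) (nI nB : nat) (A M : 'M[R]_(nI + nB)) (lam : R) :
    'M[R]_(\rank (Q_space A M lam)) :=
  let Q := Q_space A M lam in
  conjmx (row_base Q) (orthoproj Q *m DtN_hat A M lam)^T.

(* Main.v *)
Require Import Defs.
From mathcomp Require Import all_boot all_order all_algebra.
From mathcomp Require Import all_classical all_reals all_analysis.
From mathcomp Require Import complex zify ring lra.
Set Implicit Arguments.
Unset Strict Implicit.
Unset Printing Implicit Defensive.
Import Order.TTheory GRing.Theory Num.Theory.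
Import numFieldNormedType.Exports.
Local Open Scope classical_set_scope.
Local Open Scope ring_scope.

(* With k = A_II - lam M_II, c = A_IB - lam M_IB, l = A_BB - lam M_BB, and P
   the projection onto ker k, eliminating the range of k with the pseudoinverse
   shows that A - lam M is congruent to the direct sum of k (restricted to its
   range) and of [[0, P c], [(P c)^T, H]], where H is the unreduced
   Dirichlet-to-Neumann map and the first block lives on ker k.  The second
   summand splits further into rank (P c) hyperbolic planes, a zero block, and
   the restriction of H to ker (P c) = Q.  Since rank (P c) = m_D - m_in,
   Sylvester's law of inertia gives both formulas, once the counting functions
   are read as numbers of negative squares: for M positive definite, A and M are
   simultaneously diagonalizable by congruence, so that the number of
   eigenvalues of (A, M) below lam is the negative index of A - lam M.  Finally,
   M is positive definite because u^T M u is the integral of the square of a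
   continuous function which takes the values u_i at the nodes. *)

(** * Inertia of symmetric matrices *)

Definition qform (R : realFieldType) n (S : 'M[R]_n) (u : 'rV[R]_n) : R :=
  (u *m S *m u^T) 0 0.

Lemma qform_congr (R : realFieldType) p n (E : 'M[R]_(p, n)) (S : 'M[R]_n) u :
  qform (E *m S *m E^T) u = qform S (u *m E).
Proof. by rewrite /qform trmx_mul !mulmxA. Qed.

Lemma qform_block (R : realFieldType) p q (S : 'M[R]_p) (T : 'M[R]_q) u v :
  qform (block_mx S 0 0 T) (row_mx u v) = qform S u + qform T v.
Proof.
rewrite /qform mul_row_block !mulmx0 addr0 add0r tr_row_mx mul_row_col.
by rewrite [LHS]mxE.
Qed.

(* [k] is the number of negative squares and [r] the rank: there are subspaces
   of dimension [k] and [n - k] on which [S] is negative definite, resp. positive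
   semidefinite.  The rank is recorded to give the nullity. *)
Definition has_inertia (R : realFieldType) n (S : 'M[R]_n) (k r : nat) : Prop :=
  \rank S = r /\
  exists X Y : 'M[R]_n,
    [/\ (k <= \rank X)%N, (n <= \rank Y + k)%N,
        forall u : 'rV_n, (u <= X)%MS -> u != 0 -> qform S u < 0 &
        forall u : 'rV_n, (u <= Y)%MS -> 0 <= qform S u].

(** A negative definite and a positive semidefinite subspace meet only in 0, so their dimensions add
    up to at most [n]. *)
Lemma has_inertia_uniq (R : realFieldType) n (S : 'M[R]_n) k r k' r' :
  has_inertia S k r -> has_inertia S k' r' -> k = k'.
Proof.
have le_neg (X Y : 'M[R]_n) k1 k2 :
    (k1 <= \rank X)%N -> (n <= \rank Y + k2)%N ->
    (forall u : 'rV_n, (u <= X)%MS -> u != 0 -> qform S u < 0) ->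
    (forall u : 'rV_n, (u <= Y)%MS -> 0 <= qform S u) -> (k1 <= k2)%N.
  move=> hX hY negX nnegY.
  have cap0 : \rank (X :&: Y)%MS = 0%N.
    apply/eqP; rewrite mxrank_eq0; apply/rowV0P => u.
    rewrite sub_capmx => /andP[uX uY]; apply/eqP/negP => /negP u0.
    by have := negX _ uX u0; rewrite ltNge nnegY.
  have := mxrank_sum_cap X Y; rewrite cap0 addn0 => sum.
  have : (\rank (X + Y) <= n)%N by exact: rank_leq_col.
  lia.
move=> [_ [X [Y [hX hY nX nY]]]] [_ [X' [Y' [hX' hY' nX' nY']]]].
by apply/eqP; rewrite eqn_leq (le_neg X Y')// (le_neg X' Y).
Qed.

Lemma has_inertia_gen (R : realFieldType) n (S : 'M[R]_n) m1 m2
    (X : 'M[R]_(m1, n)) (Y : 'M[R]_(m2, n)) k r :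
  \rank S = r -> (k <= \rank X)%N -> (n <= \rank Y + k)%N ->
  (forall u : 'rV_n, (u <= X)%MS -> u != 0 -> qform S u < 0) ->
  (forall u : 'rV_n, (u <= Y)%MS -> 0 <= qform S u) ->
  has_inertia S k r.
Proof.
move=> rS hX hY nX nY; split=> //; exists <<X>>%MS, <<Y>>%MS.
by split; rewrite ?mxrank_gen// => u; rewrite genmxE; [exact: nX|exact: nY].
Qed.

(* [E] need not be square: the rows of [E] span the space but may be dependent,
   so that no basis adapted to the decompositions below has to be extracted. *)
Lemma has_inertia_congr (R : realFieldType) p n (E : 'M[R]_(p, n))
    (S : 'M[R]_n) k r :
  row_full E -> has_inertia (E *m S *m E^T) k r -> has_inertia S k r.
Proof.
move=> fE [rS [X [Y [hX hY nX nY]]]].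
have fET : row_free E^T by rewrite /row_free mxrank_tr.
apply: (has_inertia_gen (X := X *m E) (Y := Y *m E)).
- by rewrite -rS mxrankMfree// eqmxMfull.
(* On a vector killed by [E] the pulled-back form vanishes, so negativity on [X] makes [E] injective
   there. *)
- rewrite (_ : \rank (X *m E) = \rank X)//; apply/mxrank_injP.
  rewrite -submx0; apply/rV_subP => u.
  rewrite sub_capmx => /andP[uX /sub_kermxP uE].
  rewrite submx0; apply/negP => /negP u0; have := nX _ uX u0.
  by rewrite qform_congr uE /qform !mul0mx mxE ltxx.
(* Sylvester's rank inequality: multiplying by [E], of rank [n], lowers the rank of [Y] by at most
   [p - n]. *)
- have := mxrank_mul_min Y E; rewrite (eqP fE).
  move: (\rank Y) (\rank (_ *m _)) hY; lia.
- move=> u /submxP[D ->]; rewrite mulmxA -qform_congr => u0.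
  apply: nX; first exact: submxMl.
  by apply: contraNneq u0 => ->; rewrite mul0mx.
- move=> u /submxP[D ->]; rewrite mulmxA -qform_congr.
  by apply: nY; exact: submxMl.
Qed.

Lemma has_inertia_block (R : realFieldType) p q (S : 'M[R]_p) (T : 'M[R]_q)
    k1 r1 k2 r2 :
  has_inertia S k1 r1 -> has_inertia T k2 r2 ->
  has_inertia (block_mx S 0 0 T) (k1 + k2) (r1 + r2).
Proof.
move=> [rS [X [Y [hX hY nX nY]]]] [rT [X' [Y' [hX' hY' nX' nY']]]].
apply: (has_inertia_gen (X := block_mx X 0 0 X') (Y := block_mx Y 0 0 Y')).
- by rewrite rank_diag_block_mx rS rT.
- by rewrite rank_diag_block_mx leq_add.
- by rewrite rank_diag_block_mx; lia.
- move=> u /submxP[D ->].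
  rewrite -(hsubmxK D) mul_row_block !mulmx0 addr0 add0r.
  rewrite qform_block -row_mx0 => u0.
  have neg n (Z Q : 'M[R]_n) (v : 'rV[R]_n) :
    (forall u : 'rV_n, (u <= Z)%MS -> u != 0 -> qform Q u < 0) ->
    qform Q (v *m Z) <= 0.
    move=> h; have [->|nz] := eqVneq (v *m Z) 0.
      by rewrite /qform !mul0mx mxE.
    by rewrite ltW// h// submxMl.
  have [e|nz] := eqVneq (lsubmx D *m X) 0.
    rewrite ltr_wnDl ?neg// nX' ?submxMl//.
    by apply: contraNneq u0 => ->; rewrite e.
  by rewrite ltr_wnDr ?neg// nX ?submxMl.
- move=> u /submxP[D ->].
  rewrite -(hsubmxK D) mul_row_block !mulmx0 addr0 add0r.
  by rewrite qform_block addr_ge0// ?nY ?nY'// submxMl.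
Qed.

Lemma has_inertia_scalar (R : realFieldType) n (a : R) : a != 0 ->
  has_inertia (a%:M : 'M[R]_n) (if a < 0 then n else 0%N) n.
Proof.
move=> a0.
have qE u : qform (a%:M : 'M[R]_n) u = a * (u *m u^T) 0 0.
  by rewrite /qform mul_mx_scalar -scalemxAl mxE.
have sqr_ge (u : 'rV[R]_n) : 0 <= (u *m u^T) 0 0.
  by rewrite mxE sumr_ge0// => i _; rewrite !mxE -expr2 sqr_ge0.
have sqr_gt (u : 'rV[R]_n) : u != 0 -> 0 < (u *m u^T) 0 0.
  move=> u0; rewrite lt0r sqr_ge andbT; apply: contraNneq u0 => e.
  apply/eqP/mulmx_tr_eq0/matrixP => i j; rewrite !ord1 e.
  by rewrite mxE.
have ra : \rank (a%:M : 'M[R]_n) = n.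
  by rewrite -scalemx1 eqmx_scale// mxrank1.
case: ifPn => an.
  apply: (has_inertia_gen (X := 1%:M : 'M[R]_n) (Y := 0 : 'M[R]_n)) => //.
  - by rewrite mxrank1.
  - by rewrite mxrank0.
  - by move=> u _ /sqr_gt u0; rewrite qE nmulr_rlt0.
  - by move=> u; rewrite submx0 => /eqP->; rewrite qE mul0mx mxE mulr0.
apply: (has_inertia_gen (X := 0 : 'M[R]_n) (Y := 1%:M : 'M[R]_n)) => //.
- by rewrite mxrank1 addn0.
- by move=> u; rewrite submx0 => ->.
- by move=> u _; rewrite qE mulr_ge0// leNgt.
Qed.

Lemma has_inertia0 (R : realFieldType) n : has_inertia (0 : 'M[R]_n) 0 0.
Proof.
apply: (has_inertia_gen (X := 0 : 'M[R]_n) (Y := 1%:M : 'M[R]_n)) => //.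
- exact: mxrank0.
- by rewrite mxrank1 addn0.
- by move=> u; rewrite submx0 => ->.
by move=> u _; rewrite /qform mulmx0 mul0mx mxE.
Qed.

(** With a full-rank factorization [C = Cb *m Rb], the rows of [e] and [f] form [\rank C] hyperbolic
    pairs, [g] lifts [B], and [h] lies in the radical. In the frame [e + f], [e - f], [g], [h] the
    form is the direct sum of 2, -2, [B *m H *m B^T] and 0. *)
Lemma has_inertia_bordered (R : realFieldType) p q d (C : 'M[R]_(p, q))
    (H : 'M[R]_q) (B : 'M[R]_(d, q)) k r :
  H^T = H -> (B :=: kermx C^T)%MS -> has_inertia (B *m H *m B^T) k r ->
  has_inertia (block_mx 0 C C^T H) (\rank C + k) (\rank C + \rank C + r).
Proof.
move=> symH defB inB; set S := block_mx _ _ _ _; set s := \rank C.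
have [Cb [Rb [CE fC fR]]] : exists (Cb : 'M[R]_(p, s)) (Rb : 'M[R]_(s, q)),
    [/\ C = Cb *m Rb, row_full Cb & row_free Rb].
  exists (col_base C), (row_base C).
  by rewrite mulmx_base col_base_full row_base_free.
have [Fa FaC] : exists Fa, Fa *m Cb = 1%:M.
  by exists (pinvmx Cb); rewrite mulVpmx.
have [Fb RFb] : exists Fb : 'M[R]_(s, q), Rb *m Fb^T = 1%:M.
  by exists (pinvmx Rb)^T; rewrite trmxK mulmxVp.
have FbR : Fb *m Rb^T = 1%:M by rewrite -[RHS]trmx1 -RFb trmx_mul trmxK.
have CtE : C^T = Rb^T *m Cb^T by rewrite CE trmx_mul.
have BC : B *m C^T = 0 by apply/sub_kermxP; rewrite defB.
have CB : C *m B^T = 0 by rewrite -[C]trmxK -trmx_mul BC trmx0.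
have FCF : Fa *m C *m Fb^T = 1%:M.
  by rewrite CE -!mulmxA RFb mulmx1.
have FCF' : Fb *m C^T *m Fa^T = 1%:M.
  by rewrite -[RHS]trmx1 -FCF !trmx_mul trmxK mulmxA.
have grE m1 m2 (a : 'M[R]_(m1, p)) (b : 'M[R]_(m1, q)) (a' : 'M[R]_(m2, p)) b' :
    row_mx a b *m S *m (row_mx a' b')^T =
    a *m C *m b'^T + b *m C^T *m a'^T + b *m H *m b'^T.
  rewrite mul_row_block mulmx0 add0r tr_row_mx mul_row_col mulmxDl.
  by rewrite addrA [in LHS](addrC (b *m C^T *m a'^T)).
pose N := Fb *m H *m Fb^T.
have half m n (x : 'M[R]_(m, n)) : 2^-1 *: x + 2^-1 *: x = x.
  by rewrite -scalerDl -[RHS]scale1r; congr (_ *: _); lra.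
(* [N2] is half of [N]: being symmetric, it occurs twice in the square of [f] and cancels [N]. *)
have [N2 [N2N symN2]] : exists N2, N2 + N2 = N /\ N2^T = N2.
  exists (2^-1 *: N); split; first exact: half.
  by rewrite linearZ /= /N !trmx_mul trmxK symH mulmxA.
pose e := row_mx Fa (0 : 'M[R]_(s, q)).
(* The correction terms make [f] isotropic and [g] orthogonal to [f]. *)
pose f := row_mx (- N2 *m Fa) Fb.
pose g := row_mx (- (B *m H *m Fb^T) *m Fa) B.
pose h := row_mx (kermx C) (0 : 'M[R]_(p, q)).
have ee : e *m S *m e^T = 0 by rewrite grE trmx0 !mulmx0 !mul0mx !addr0.
have ef : e *m S *m f^T = 1%:M by rewrite grE !mul0mx !addr0.
have eg : e *m S *m g^T = 0.
  by rewrite grE !mul0mx !addr0 -mulmxA CB mulmx0.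
have eh : e *m S *m h^T = 0 by rewrite grE trmx0 !mulmx0 !mul0mx !addr0.
have ff : f *m S *m f^T = 0.
  rewrite grE -!mulmxA (mulmxA Fa) FCF mulmx1 (mulmxA Fb) trmx_mul.
  rewrite (mulmxA _ Fa^T).
  rewrite FCF' mul1mx linearN /= symN2 -opprD N2N (mulmxA Fb) -/N.
  by rewrite addNr.
have fg : f *m S *m g^T = 0.
  rewrite grE -!mulmxA CB !mulmx0 add0r trmx_mul (mulmxA C^T) (mulmxA Fb).
  rewrite (mulmxA Fb) FCF' mul1mx linearN /= !trmx_mul trmxK symH.
  by rewrite !mulmxA addNr.
have kC : kermx C *m C = 0 by exact: mulmx_ker.
have Ck : C^T *m (kermx C)^T = 0 by rewrite -trmx_mul kC trmx0.
have fh : f *m S *m h^T = 0.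
  by rewrite grE trmx0 !mulmx0 -(mulmxA Fb) Ck mulmx0 !addr0.
have gg : g *m S *m g^T = B *m H *m B^T.
  by rewrite grE BC !mul0mx addr0 -!mulmxA CB !mulmx0 add0r.
have gh : g *m S *m h^T = 0.
  by rewrite grE trmx0 BC !mul0mx !mulmx0 !addr0.
have hh : h *m S *m h^T = 0.
  by rewrite grE trmx0 !mul0mx !mulmx0 !addr0.
have symS : S^T = S by rewrite /S tr_block_mx trmx0 trmxK symH.
have flip m1 m2 (x : 'M[R]_(m1, p + q)) (y : 'M[R]_(m2, p + q)) :
    y *m S *m x^T = (x *m S *m y^T)^T.
  by rewrite !trmx_mul trmxK symS mulmxA.
pose E := col_mx (col_mx (e + f) (e - f)) (col_mx g h).
apply: (has_inertia_congr (E := E)).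
  rewrite -sub1mx.
  have le_u m1 m2 m n (x : 'M[R]_(m1, n)) (y : 'M[R]_(m2, n))
      (z : 'M[R]_(m, n)) : (col_mx x y <= z)%MS -> (x <= z)%MS.
    by rewrite -addsmxE addsmx_sub => /andP[].
  have le_d m1 m2 m n (x : 'M[R]_(m1, n)) (y : 'M[R]_(m2, n))
      (z : 'M[R]_(m, n)) : (col_mx x y <= z)%MS -> (y <= z)%MS.
    by rewrite -addsmxE addsmx_sub => /andP[].
  have efE : (col_mx (e + f) (e - f) <= E)%MS by exact: le_u (submx_refl E).
  have ghE : (col_mx g h <= E)%MS by exact: le_d (submx_refl E).
  have eDfE : ((e + f)%R <= E)%MS by exact: le_u efE.
  have eBfE : ((e - f)%R <= E)%MS by exact: le_d efE.
  have gE : (g <= E)%MS by exact: le_u ghE.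
  have hE : (h <= E)%MS by exact: le_d ghE.
  have eE : (e <= E)%MS.
    have -> : e = 2^-1 *: (e + f) + 2^-1 *: (e - f).
      by rewrite -scalerDr addrACA subrr addr0 scalerDr half.
    by rewrite addmx_sub ?scalemx_sub.
  have fE : (f <= E)%MS.
    have -> : f = (e + f) - e by rewrite addrC addKr.
    by rewrite addmx_sub ?eqmx_opp.
  (* [x *m Cb *m Fa] has the same image under [C] as [x]; the difference is a combination of the
     rows of [kermx C], hence comes from [h]. *)
  have aE m (x : 'M[R]_(m, p)) : (row_mx x (0 : 'M[R]_(m, q)) <= E)%MS.
    have /submxP[D DE] : ((x - x *m Cb *m Fa)%R <= kermx C)%MS.
      apply/sub_kermxP; rewrite mulmxBl {2}CE -!mulmxA (mulmxA Fa).
      by rewrite FaC mul1mx -CE subrr.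
    have -> : row_mx x (0 : 'M[R]_(m, q)) = (x *m Cb) *m e + D *m h.
      by rewrite !mul_mx_row !mulmx0 add_row_mx addr0 -DE addrC subrK.
    by rewrite addmx_sub// (submx_trans (submxMl _ _)).
  have bE m (x : 'M[R]_(m, q)) : (row_mx (0 : 'M[R]_(m, p)) x <= E)%MS.
    have /submxP[D DE] : ((x - x *m Rb^T *m Fb)%R <= B)%MS.
      rewrite defB; apply/sub_kermxP.
      by rewrite mulmxBl CtE -!mulmxA (mulmxA Fb) FbR mul1mx subrr.
    (* The first components brought in by the corrections in [f] and [g] are removed by means of
       [aE]. *)
    have -> : row_mx (0 : 'M[R]_(m, p)) x = (x *m Rb^T) *m f + D *m g
        + row_mx (- (x *m Rb^T *m (- N2 *m Fa) +
                     D *m (- (B *m H *m Fb^T) *m Fa))) 0.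
      by rewrite !mul_mx_row !add_row_mx subrr addr0 -DE addrC subrK.
    by rewrite !addmx_sub// (submx_trans (submxMl _ _)).
  rewrite -(vsubmxK 1%:M) -addsmxE addsmx_sub.
  apply/andP; split.
    rewrite -[usubmx _]hsubmxK -[lsubmx _]addr0 -[rsubmx _]add0r -add_row_mx.
    by rewrite addmx_sub.
  rewrite -[dsubmx _]hsubmxK -[lsubmx _]addr0 -[rsubmx _]add0r -add_row_mx.
  by rewrite addmx_sub.
have fe : f *m S *m e^T = 1%:M by rewrite flip ef trmx1.
have -> : E *m S *m E^T = block_mx (block_mx 2%:M 0 0 (-2)%:M) 0 0
                                   (block_mx (B *m H *m B^T) 0 0 0).
  have -> : E *m S = col_mx (col_mx ((e + f) *m S) ((e - f) *m S))
                            (col_mx (g *m S) (h *m S)) by rewrite !mul_col_mx.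
  have -> : E^T = row_mx (row_mx (e + f)^T (e - f)^T) (row_mx g^T h^T).
    by rewrite !tr_col_mx.
  rewrite mul_col_row.
  have eDf : (e + f)^T = e^T + f^T by rewrite linearD.
  have eBf : (e - f)^T = e^T - f^T by rewrite linearB.
  have -> : col_mx ((e + f) *m S) ((e - f) *m S) *m row_mx g^T h^T = 0.
    rewrite mul_col_row mulmxDl mulmxBl !mulmxDl !mulNmx eg eh fg fh.
    by rewrite !subr0 !addr0 block_mx0.
  have -> : col_mx (g *m S) (h *m S) *m row_mx (e + f)^T (e - f)^T = 0.
    rewrite mul_col_row eDf eBf !mulmxDr !mulmxN.
    rewrite (flip _ _ e g) (flip _ _ f g) (flip _ _ e h) (flip _ _ f h).
    by rewrite eg eh fg fh !trmx0 !subr0 !addr0 block_mx0.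
  rewrite !mul_col_row.
  have -> : (e + f) *m S *m (e + f)^T = 2%:M.
    rewrite eDf !(mulmxDl, mulmxDr) ee ef fe ff addr0 add0r.
    by rewrite -raddfD.
  have -> : (e + f) *m S *m (e - f)^T = 0.
    rewrite eBf !(mulmxDl, mulmxDr, mulmxN) ee ef fe ff.
    by rewrite !(addr0, add0r, oppr0) subrr.
  have -> : (e - f) *m S *m (e + f)^T = 0.
    rewrite eDf !(mulmxDl, mulmxDr, mulNmx) ee ef fe ff.
    by rewrite !(addr0, add0r, oppr0) addNr.
  have -> : (e - f) *m S *m (e - f)^T = (-2)%:M.
    rewrite eBf !(mulmxDl, mulmxDr, mulNmx, mulmxN) ee ef fe ff.
    by rewrite !(addr0, add0r, oppr0) -opprD -raddfD -raddfN.
  by rewrite gg gh hh (flip _ _ g h) gh trmx0.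
have i2 : has_inertia (2%:M : 'M[R]_s) 0 s.
  have := @has_inertia_scalar R s 2.
  by rewrite pnatr_eq0 [2 < 0]ltNge ler0n; exact.
have im2 : has_inertia ((-2)%:M : 'M[R]_s) s s.
  have := @has_inertia_scalar R s (- 2).
  by rewrite oppr_eq0 pnatr_eq0 oppr_lt0 ltr0n; exact.
have := has_inertia_block (has_inertia_block i2 im2)
          (has_inertia_block inB (has_inertia0 R p)).
by rewrite add0n !addn0.
Qed.

(** * Symmetric-definite pencils *)

Definition posdef (R : realFieldType) n (M : 'M[R]_n) : Prop :=
  M^T = M /\ forall u, u != 0 -> 0 < qform M u.

Lemma posdef_unit (R : realFieldType) n (M : 'M[R]_n) :
  posdef M -> M \in unitmx.
Proof.
move=> [_ pM]; rewrite -row_free_unit -kermx_eq0.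
apply/rowV0P => u /sub_kermxP uM.
apply/eqP; apply: contraT => /pM.
by rewrite /qform uM mul0mx mxE ltxx.
Qed.

Lemma posdef_congr (R : realFieldType) m n (B : 'M[R]_(m, n)) (M : 'M[R]_n) :
  row_free B -> posdef M -> posdef (B *m M *m B^T).
Proof.
move=> fB [sM pM]; split; first by rewrite !trmx_mul trmxK sM mulmxA.
move=> u u0; rewrite qform_congr pM//; apply: contraNneq u0 => uB.
by apply/eqP/(row_free_inj fB); rewrite uB mul0mx.
Qed.

(* A complex eigenvector x + i y for a + i b satisfies
   b (x M x^T + y M y^T) = 0, hence b = 0. *)
Lemma pencil_eigenvector (R : rcfType) n (A M : 'M[R]_n.+1) :
  A^T = A -> posdef M ->
  exists s (v : 'rV[R]_n.+1), v != 0 /\ v *m A = s *: (v *m M).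
Proof.
move=> sA pM; have uM := posdef_unit pM; case: pM => sM pM.
have M_ge0 u : 0 <= qform M u.
  by have [->|/pM/ltW//] := eqVneq u 0; rewrite /qform !mul0mx mxE.
(* A left eigenvector of [K] solves [v A = c v M]. One exists over the complex extension of [R],
   which is algebraically closed; [x] and [y] are its real and imaginary parts. *)
set K := A *m invmx M.
have [c] := eigenvalue_closed (map_mx (real_complex R) K) isT.
case: c => a b /eigenvalueP [v vK v0].
pose x := map_mx (@complex.Re R) v; pose y := map_mx (@complex.Im R) v.
have xK : x *m K = a *: x - b *: y.
  apply/rowP => j; have /rowP/(_ j) := vK.
  rewrite !mxE => /(congr1 (@complex.Re R)).
  rewrite raddf_sum/= => e.
  transitivity (complex.Re ((a +i* b)%C * v 0 j)).
    rewrite -e; apply: eq_bigr => i _; rewrite !mxE.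
    by case: (v 0 i) => p q /=; ring.
  by case: (v 0 j) => p q /=; ring.
have yK : y *m K = a *: y + b *: x.
  apply/rowP => j; have /rowP/(_ j) := vK.
  rewrite !mxE => /(congr1 (@complex.Im R)).
  rewrite raddf_sum/= => e.
  transitivity (complex.Im ((a +i* b)%C * v 0 j)).
    rewrite -e; apply: eq_bigr => i _; rewrite !mxE.
    by case: (v 0 i) => p q /=; ring.
  by case: (v 0 j) => p q /=; ring.
have KM : K *m M = A by rewrite mulmxKV.
have xA : x *m A = a *: (x *m M) - b *: (y *m M).
  by rewrite -KM mulmxA xK mulmxBl -!scalemxAl.
have yA : y *m A = a *: (y *m M) + b *: (x *m M).
  by rewrite -KM mulmxA yK mulmxDl -!scalemxAl.
have xy0 : (x != 0) || (y != 0).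
  rewrite -negb_and; apply: contra v0 => /andP[/eqP/rowP x0 /eqP/rowP y0].
  apply/eqP/rowP => j; have := x0 j; have := y0 j; rewrite !mxE.
  by case: (v 0 j) => p q /= -> ->.
have b0 : b = 0.
  have tr11 (z : 'M[R]_1) : z^T = z by apply/matrixP => i j; rewrite mxE !ord1.
  have e1 : x *m A *m y^T = y *m A *m x^T.
    by rewrite -[LHS]tr11 !trmx_mul trmxK sA mulmxA.
  have e2 : x *m M *m y^T = y *m M *m x^T.
    by rewrite -[LHS]tr11 !trmx_mul trmxK sM mulmxA.
  move: e1; rewrite xA yA mulmxBl mulmxDl -!scalemxAl e2.
  move=> /addrI/matrixP/(_ 0 0) e.
  have {}e : - (b * qform M y) = b * qform M x by move: e; rewrite /qform !mxE.
  have /eqP : b * (qform M x + qform M y) = 0 by rewrite mulrDr -e addNr.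
  move=> b0; apply/eqP; move: b0.
  rewrite mulf_eq0 => /orP[//|]; rewrite gt_eqF//.
  by case/orP: xy0 => /pM z0; [rewrite ltr_wpDr|rewrite ltr_wpDl].
case/orP: xy0 => nz.
  by exists a, x; rewrite xA b0 scale0r subr0.
by exists a, y; rewrite yA b0 scale0r addr0.
Qed.

(** Induction on [n]: split off an [M]-normalized eigenvector [w] and restrict both forms to its
    [M]-orthogonal complement, spanned by [B]. *)
Lemma pencil_diagonalization (R : rcfType) n (A M : 'M[R]_n) :
  A^T = A -> posdef M ->
  exists (V : 'M[R]_n) (d : 'rV[R]_n),
    V *m M *m V^T = 1%:M /\ V *m A *m V^T = diag_mx d.
Proof.
elim: n A M => [|n IHn] A M sA pM.
  by exists 0, 0; split; apply/matrixP => -[].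
have [s [v [v0 vA]]] := pencil_eigenvector sA pM.
have [sM M_gt0] := pM.
pose t := Num.sqrt (qform M v); have t0 : 0 < t by rewrite sqrtr_gt0 M_gt0.
pose w := t^-1 *: v.
have wA : w *m A = s *: (w *m M) by rewrite -!scalemxAl vA !scalerA mulrC.
have wMw : w *m M *m w^T = 1%:M.
  apply/matrixP => i j; rewrite !ord1 /w linearZ /= -!scalemxAl -scalemxAr.
  rewrite scalerA.
  rewrite mxE -/(qform M v) -[qform M v](sqr_sqrtr (ltW (M_gt0 _ v0))) -/t mxE.
  by rewrite eqxx expr2 mulrACA mulVf ?gt_eqF// mulr1.
have rW : \rank (kermx (M *m w^T)) = n.
  rewrite mxrank_ker -(mxrank_tr (M *m _)) rank_rV.
  suff -> : (M *m w^T)^T != 0 by rewrite subn1.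
  apply: contra_eq_neq wMw => /(congr1 trmx); rewrite trmxK -mulmxA => ->.
  rewrite trmx0 mulmx0; apply/negP => /eqP/matrixP/(_ 0 0)/eqP.
  by rewrite !mxE eq_sym oner_eq0.
(* A row basis has as many rows as the rank; naming that number [k] allows it to be replaced by [n],
   as the type in the induction hypothesis requires. *)
have basis k : \rank (kermx (M *m w^T)) = k -> exists B : 'M[R]_(k, n.+1),
    row_free B /\ B *m M *m w^T = 0.
  move=> <-; exists (row_base (kermx (M *m w^T))).
  split; first exact: row_base_free.
  by rewrite -mulmxA; apply/sub_kermxP; rewrite eq_row_base.
have [B [fB BM]] := basis _ rW.
have wMB : w *m M *m B^T = 0.
  by apply: trmx_inj; rewrite !trmx_mul trmxK sM trmx0 mulmxA.
have [V' [d' [VM VA]]] := IHn (B *m A *m B^T) (B *m M *m B^T)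
  (ltac:(by rewrite !trmx_mul trmxK sA mulmxA)) (posdef_congr fB pM).
(* Since [w A = s w M], orthogonality to [w] for [M] implies orthogonality for [A], so both Gram
   matrices are block diagonal. *)
have BA : B *m A *m w^T = 0.
  apply: trmx_inj; rewrite !trmx_mul trmxK sA trmx0 mulmxA wA -scalemxAl wMB.
  exact: scaler0.
have wAB : w *m A *m B^T = 0 by rewrite wA -scalemxAl wMB scaler0.
have gram (X : 'M[R]_n.+1) : w *m X *m B^T = 0 -> B *m X *m w^T = 0 ->
    (col_mx w (V' *m B) : 'M[R]_(1 + n)) *m X
      *m (col_mx w (V' *m B) : 'M[R]_(1 + n))^T =
    block_mx (w *m X *m w^T) 0 0 (V' *m (B *m X *m B^T) *m V'^T).
  move=> wXB BXw; rewrite (tr_col_mx w) (mul_col_mx w) (mul_col_row (w *m X)).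
  rewrite trmx_mul (mulmxA (w *m X)) wXB mul0mx -!(mulmxA V') BXw.
  by rewrite mulmx0 !mulmxA.
exists (col_mx w (V' *m B) : 'M[R]_(1 + n)), (row_mx s%:M d' : 'rV[R]_(1 + n)).
split.
  by rewrite gram// wMw VM [RHS](@scalar_mx_block _ 1 n).
rewrite gram// VA.
have -> : w *m A *m w^T = s%:M by rewrite wA -scalemxAl wMw scalemx1.
have ds : diag_mx s%:M = s%:M :> 'M[R]_1.
  by apply/matrixP => i j; rewrite !ord1 !mxE.
by rewrite [RHS](diag_mx_row s%:M d') ds.
Qed.

(** The witnesses are the coordinate subspace of the negative entries and the complementary one;
    [I P] has the unit vectors indexed by [P] as rows. *)
Lemma has_inertia_diag (R : realFieldType) n (d : 'rV[R]_n) :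
  has_inertia (diag_mx d)
    #|[set i | d 0 i < 0]%SET| #|[set i | d 0 i != 0]%SET|.
Proof.
have qE (u : 'rV_n) : qform (diag_mx d) u = \sum_i d 0 i * u 0 i ^+ 2.
  rewrite /qform mul_mx_diag mxE; apply: eq_bigr => i _; rewrite !mxE; ring.
pose I (P : {set 'I_n}) : 'M[R]_(#|P|, n) := rowsub enum_val 1%:M.
have rI P : \rank (I P) = #|P|.
  apply/eqP/row_freeP; exists (I P)^T.
  rewrite /I -rowsubE; apply/matrixP => i j.
  by rewrite !mxE eq_sym (inj_eq enum_val_inj).
have subI P (u : 'rV_n) : (u <= I P)%MS -> forall i, i \notin P -> u 0 i = 0.
  move=> /submxP[D ->] i iP; rewrite mxE big1// => k _; rewrite !mxE.
  case: eqP => [e|_]; last by rewrite mulr0.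
  by rewrite -e enum_valP in iP.
apply: (has_inertia_gen (X := I [set i | d 0 i < 0]%SET)
                        (Y := I (~: [set i | d 0 i < 0])%SET)).
- rewrite -rI; apply/eqmx_rank/andP; split; apply/row_subP => i.
    rewrite row_diag_mx; have [->|di] := eqVneq (d 0 i) 0.
      by rewrite scale0r sub0mx.
    apply: scalemx_sub; have iP : i \in [set i | d 0 i != 0]%SET by rewrite inE.
    apply: (submx_trans _ (row_sub (enum_rank_in iP i) _)).
    by rewrite /I row_rowsub enum_rankK_in// row1.
  rewrite /I row_rowsub; have := enum_valP i; rewrite inE => di.
  apply: (submx_trans _ (row_sub (enum_val i) _)).
  by rewrite row_diag_mx row1 eqmx_scale.
- by rewrite rI.
- by rewrite rI addnC cardsC card_ord.
- move=> u /subI uI u0; rewrite qE.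
  have [i ui] : exists i, u 0 i != 0.
    apply/existsP; apply: contraNT u0 => /existsPn h; apply/eqP/rowP => i.
    by rewrite mxE; apply/eqP; rewrite -[_ == _]negbK h.
  rewrite (bigD1 i)//= ltr_wnDr//.
    apply: sumr_le0 => j _; have [dj|dj] := ltP (d 0 j) 0.
      by rewrite mulr_le0_ge0 ?sqr_ge0// ltW.
    by rewrite uI ?expr0n ?mulr0// inE -leNgt.
  rewrite pmulr_llt0 ?exprn_even_gt0//.
  by apply: contraNT ui => di; rewrite uI// inE.
- move=> u /subI uI; rewrite qE sumr_ge0// => i _.
  have [di|di] := leP 0 (d 0 i); first by rewrite mulr_ge0// sqr_ge0.
  by rewrite uI ?expr0n ?mulr0// !inE di.
Qed.

Lemma mult_rank (R : realType) n (A M : 'M[R]_n) s :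
  mult A M s = (n - \rank (pencil A M s))%N.
Proof. by rewrite /mult /colker mxrank_ker mxrank_tr. Qed.

(** In a diagonalizing frame the pencil at [s] is the diagonal matrix of the [d 0 i - s], so [mult]
    counts the entries equal to [s] and the negative index counts those below [s]. *)
Lemma has_inertia_counting (R : realType) n (A M : 'M[R]_n) lam :
  A^T = A -> posdef M ->
  has_inertia (pencil A M lam) (Defs.counting A M lam) (n - mult A M lam).
Proof.
move=> sA pM; have [V [d [VM VA]]] := pencil_diagonalization sA pM.
have fV : row_full V.
  rewrite row_full_unit.
  by have := mulmx1_unit (etrans (mulmxA _ _ _) VM); case.
have inertia s : has_inertia (pencil A M s) #|[set i | d 0 i < s]%SET|
                   #|[set i | d 0 i != s]%SET|.
  apply: (has_inertia_congr fV).
  have -> : V *m pencil A M s *m V^T = diag_mx (d - const_mx s).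
    rewrite /pencil mulmxBr mulmxBl VA -scalemxAr -scalemxAl VM scalemx1.
    by apply/matrixP => i j; rewrite !mxE mulrnBl.
  have := has_inertia_diag (d - const_mx s).
  by congr has_inertia; apply: eq_card => i;
    rewrite !inE !mxE ?subr_lt0 ?subr_eq0.
have multE s : mult A M s = #|[set i | d 0 i == s]%SET|.
  rewrite mult_rank (inertia s).1 -[n in (n - _)%N]card_ord.
  rewrite -(cardsC [set i | d 0 i != s]%SET) addKn.
  by apply: eq_card => i; rewrite !inE negbK.
have -> : (n - mult A M lam)%N = #|[set i | d 0 i != lam]%SET|.
  by rewrite mult_rank subKn ?rank_leq_row// (inertia lam).1.
suff -> : Defs.counting A M lam = #|[set i | d 0 i < lam]%SET| by [].
rewrite /Defs.counting.
(* [r] lists the distinct entries below [lam]; it contains all indices of nonzero terms, so the sum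
   over an infinite set becomes a finite one. *)
pose r := undup [seq d 0 i | i <- enum 'I_n & d 0 i < lam].
have mem_r i : (d 0 i \in r) = (d 0 i < lam).
  rewrite mem_undup; apply/mapP/idP => [[j]|h].
    by rewrite mem_filter => /andP[? _] ->.
  by exists i => //; rewrite mem_filter h mem_enum.
have r_lt s : s \in r -> s < lam.
  rewrite mem_undup => /mapP[j]; rewrite mem_filter => /andP[jlam _] -> //.
rewrite (fsbigE r) ?undup_uniq//; last first.
  move=> s /= slam sr; rewrite multE; apply: eq_card0 => i; rewrite inE.
  by apply: contraNF sr => /eqP ds; rewrite -ds mem_r ds.
rewrite big_seq_cond (eq_bigl (fun s => s \in r)); last first.
  by move=> s; case: (boolP (s \in r)) => //= /r_lt sl; rewrite mem_set.
rewrite -big_seq.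
rewrite (eq_bigr (fun s => \big[addn/0%N]_(i < n) (d 0 i == s : nat)));
  last first.
  by move=> s _; rewrite multE -sum1dep_card big_mkcond.
(* After the exchange, index [i] contributes the number of occurrences of [d 0 i] in the
   duplicate-free [r]: 1 if [d 0 i < lam], else 0. *)
rewrite exchange_big /= -sum1dep_card [RHS]big_mkcond; apply: eq_bigr => i _.
rewrite -mem_r -[RHS]/(nat_of_bool _) -(count_uniq_mem _ (undup_uniq _)).
rewrite -sum1_count [RHS]big_mkcond.
by apply: eq_bigr => s _; rewrite eq_sym.
Qed.

(** * The reduced Dirichlet-to-Neumann map *)

(** The transpose satisfies the Penrose equations of [k] as well, and these have only one
    solution. *)
Lemma moore_penrose_sym (R : realFieldType) n (k : 'M[R]_n) :
  k^T = k -> (moore_penrose k)^T = moore_penrose k.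
Proof.
move=> sk; have kP := moore_penroseP k.
apply: (moore_penrose_uniq _ kP).
move: (moore_penrose k) kP => kp [e1 e2 e3 e4].
split.
- by rewrite -{1 2 3}sk -!trmx_mul mulmxA e1.
- by rewrite -{1}sk -!trmx_mul mulmxA e2.
- by rewrite trmx_mul trmxK sk -e4 trmx_mul sk.
- by rewrite trmx_mul trmxK sk -e3 trmx_mul sk.
Qed.

Lemma mulmx_moore_penrose_sym (R : realFieldType) n (k : 'M[R]_n) :
  k^T = k -> k *m moore_penrose k = moore_penrose k *m k.
Proof.
move=> sk; have [_ _ _ e4] := moore_penroseP k.
by rewrite -e4 trmx_mul sk moore_penrose_sym.
Qed.

Lemma sym_congr (R : comPzRingType) m n (B : 'M[R]_(m, n)) (S : 'M[R]_n) :
  S^T = S -> (B *m S *m B^T)^T = B *m S *m B^T.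
Proof. by move=> sS; rewrite !trmx_mul trmxK sS mulmxA. Qed.

Lemma eq_mulmx_cV (R : pzSemiRingType) m n (X Y : 'M[R]_(m, n)) :
  (forall u : 'cV_n, X *m u = Y *m u) -> X = Y.
Proof.
move=> XY; apply/matrixP => i j; have /matrixP/(_ i 0) := XY (delta_mx j 0).
by rewrite -!colE !mxE.
Qed.

Lemma orthoproj_id (R : realFieldType) m n (U : 'M[R]_(m, n)) :
  U *m orthoproj U = U.
Proof.
apply: eq_mulmx_cV => u; apply/eqP.
by rewrite eq_sym -subr_eq0 -mulmxA -mulmxBr orthoproj_ortho.
Qed.

Lemma orthoproj_tr_sub (R : realFieldType) m n (U : 'M[R]_(m, n)) :
  ((orthoproj U)^T <= U)%MS.
Proof.
rewrite trmxK -[proj_mx _ _]mul1mx.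
by rewrite (submx_trans (proj_mx_sub _ _ _)) ?genmxE.
Qed.

(** Let [Q] be the right-hand side. Its rows lie in the kernel, so [Q = Q *m P]; and [k *m P = 0]
    gives [Q *m P = P]. *)
Lemma orthoproj_colker (R : realFieldType) n (k : 'M[R]_n) :
  k^T = k -> orthoproj (colker k) = 1%:M - moore_penrose k *m k.
Proof.
move=> sk; set U := colker k; set P := orthoproj U.
have [e1 _ _ e4] := moore_penroseP k; set kp := moore_penrose k in e1 e4 *.
have kP : k *m P = 0.
  apply: eq_mulmx_cV => u; rewrite mul0mx -mulmxA.
  exact/colkerP/orthoproj_sub.
set Q := 1%:M - kp *m k.
have sQ : Q^T = Q by rewrite /Q raddfB /= trmx1 e4.
have kQ : k *m Q = 0 by rewrite mulmxBr mulmx1 mulmxA e1 subrr.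
have /submxP[D QD] : (Q <= U)%MS.
  by apply/sub_kermxP; rewrite -sQ -trmx_mul kQ trmx0.
have -> : Q = Q *m P by rewrite {2}QD -mulmxA orthoproj_id.
by rewrite mulmxBl mul1mx -mulmxA kP mulmx0 subr0.
Qed.

(** If [K *m C^T *m C = 0], then [K *m C^T] times its own transpose is 0. This identifies [Q_space]
    with the kernel of the coupling projected to the kernel of [k]. *)
Lemma kermx_gram (R : realFieldType) m n (C : 'M[R]_(m, n)) :
  (kermx (C^T *m C)^T :=: kermx C^T)%MS.
Proof.
rewrite trmx_mul trmxK; apply/eqmxP/andP; split; last first.
  by apply/sub_kermxP; rewrite mulmxA mulmx_ker mul0mx.
apply/sub_kermxP/mulmx_tr_eq0; set K := kermx _.
by rewrite trmx_mul trmxK mulmxA -(mulmxA K) mulmx_ker mul0mx.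
Qed.

Lemma schur_sym (R : realFieldType) p q (k : 'M[R]_p) (c : 'M[R]_(p, q))
    (l : 'M[R]_q) : k^T = k -> l^T = l ->
  (l - c^T *m moore_penrose k *m c)^T = l - c^T *m moore_penrose k *m c.
Proof.
move=> sk sl; rewrite raddfB /= !trmx_mul trmxK moore_penrose_sym// sl.
by rewrite mulmxA.
Qed.

(** [E1] spans the range of [k], [E2] its kernel, and [E3] extends boundary vectors to the interior
    so as to eliminate the coupling with the range. [E1] is orthogonal to [E2] and [E3], whose joint
    Gram matrix is a bordered one. *)
Lemma has_inertia_schur (R : realFieldType) p q (k : 'M[R]_p) (c : 'M[R]_(p, q))
    (l : 'M[R]_q) (i1 i2 r1 r2 : nat) d (B : 'M[R]_(d, q)) :
  let P := orthoproj (colker k) in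
  k^T = k -> l^T = l -> has_inertia k i1 r1 ->
  (B :=: kermx (P *m c)^T)%MS ->
  has_inertia (B *m (l - c^T *m moore_penrose k *m c) *m B^T) i2 r2 ->
  has_inertia (block_mx k c c^T l) (i1 + (\rank (P *m c) + i2))
    (r1 + (\rank (P *m c) + \rank (P *m c) + r2)).
Proof.
move=> P sk sl ik defB iB.
have [e1 e2 _ e4] := moore_penroseP k.
have skp := moore_penrose_sym sk; have comm := mulmx_moore_penrose_sym sk.
have PE : P = 1%:M - moore_penrose k *m k := orthoproj_colker sk.
set kp := moore_penrose k in e1 e2 e4 skp comm PE iB *.
have kP : k *m P = 0 by rewrite PE mulmxBr mulmx1 mulmxA e1 subrr.
have sP : P^T = P by rewrite PE raddfB /= trmx1 e4.
have Pk : P *m k = 0 by rewrite -[RHS]trmx0 -kP trmx_mul sk sP.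
have kpP : kp *m P = 0 by rewrite PE mulmxBr mulmx1 -comm mulmxA e2 subrr.
set H := l - _ in iB.
have sH : H^T = H by apply: schur_sym.
set S := block_mx k c c^T l.
pose E1 : 'M[R]_(p, p + q) := row_mx (kp *m k) 0.
pose E2 : 'M[R]_(p, p + q) := row_mx P 0.
pose E3 : 'M[R]_(q, p + q) := row_mx (- (c^T *m kp)) 1%:M.
pose F := col_mx E2 E3.
apply: (has_inertia_congr (E := col_mx E1 F)).
  rewrite -sub1mx.
  (* [D] is a left inverse of the frame: [E1 + E2] is the interior identity, and adding [c^T *m kp]
     times it to [E3] leaves the boundary identity. *)
  pose D : 'M[R]_(p + q, p + (p + q)) :=
    col_mx (row_mx 1%:M (row_mx 1%:M 0))
           (row_mx (c^T *m kp) (row_mx (c^T *m kp) 1%:M)).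
  apply/submxP; exists D; rewrite /D /F !mul_col_mx !mul_row_col.
  have kpkP : kp *m k + P = 1%:M by rewrite PE addrC subrK.
  rewrite !mul1mx mul0mx addr0 !mul_mx_row !mulmx0 !add_row_mx !addr0 !add0r.
  by rewrite addrA -mulmxDr kpkP mulmx1 subrr scalar_mx_block.
have grE m1 m2 (a : 'M[R]_(m1, p)) (b : 'M[R]_(m1, q)) (a' : 'M[R]_(m2, p)) b' :
    row_mx a b *m S *m (row_mx a' b')^T =
    (a *m k + b *m c^T) *m a'^T + (a *m c + b *m l) *m b'^T.
  by rewrite mul_row_block tr_row_mx mul_row_col.
(* The redundant rows of [E1] reproduce [k] itself, so its inertia enters directly. *)
have S11 : E1 *m S *m E1^T = k.
  rewrite grE trmx0 mulmx0 mul0mx !addr0 e4 -{1}comm e1.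
  by rewrite mulmxA e1.
have S12 : E1 *m S *m E2^T = 0.
  by rewrite grE trmx0 mulmx0 mul0mx !addr0 sP -mulmxA kP mulmx0.
have S3 : E3 *m S = row_mx (c^T *m P) H.
  rewrite mul_row_block !mul1mx !mulNmx PE mulmxBr mulmx1 mulmxA.
  by rewrite addrC; congr row_mx; rewrite addrC.
have S31 : E3 *m S *m E1^T = 0.
  rewrite S3 tr_row_mx mul_row_col trmx0 mulmx0 addr0 e4 -comm.
  by rewrite -(mulmxA c^T) (mulmxA P) Pk mul0mx mulmx0.
have S32 : E3 *m S *m E2^T = (P *m c)^T.
  rewrite S3 tr_row_mx mul_row_col trmx0 mulmx0 addr0 sP -mulmxA trmx_mul sP.
  by rewrite {2}PE mulmxBr mulmx1 -comm mulmxA Pk mul0mx subr0.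
have S33 : E3 *m S *m E3^T = H.
  rewrite S3 tr_row_mx mul_row_col trmx1 mulmx1 raddfN /= trmx_mul trmxK skp.
  by rewrite mulmxN -mulmxA (mulmxA P) -[P *m kp]trmxK trmx_mul skp sP kpP trmx0
     mul0mx mulmx0 oppr0 add0r.
have S22 : E2 *m S *m E2^T = 0.
  by rewrite grE trmx0 mulmx0 mul0mx !addr0 Pk mul0mx.
have symS : S^T = S by rewrite /S tr_block_mx trmxK sk sl.
have flip m1 m2 (x : 'M[R]_(m1, p + q)) (y : 'M[R]_(m2, p + q)) :
    y *m S *m x^T = (x *m S *m y^T)^T.
  by rewrite !trmx_mul trmxK symS mulmxA.
have iC := has_inertia_bordered sH defB iB.
have := has_inertia_block ik iC; congr has_inertia.
have S13 : E1 *m S *m E3^T = 0 by rewrite flip S31 trmx0.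
have S23 : E2 *m S *m E3^T = P *m c by rewrite flip S32 trmxK.
have FT : F^T = row_mx E2^T E3^T by rewrite tr_col_mx.
have ET : (col_mx E1 F)^T = row_mx E1^T F^T by rewrite tr_col_mx.
rewrite ET mul_col_mx mul_col_row FT mul_mx_row S11 S12 S13 row_mx0.
rewrite mul_col_mx mul_col_row S22 S23 S32 S33.
by rewrite mul_col_mx S31 flip S12 trmx0 col_mx0.
Qed.

(** Rank-nullity for [c] on the kernel of [k], which is the row space of [P]. *)
Lemma inner_rank (R : realFieldType) p q (k : 'M[R]_p) (c : 'M[R]_(p, q)) :
  k^T = k ->
  (\rank (colker k :&: colker c^T) + \rank (orthoproj (colker k) *m c) =
   \rank (colker k))%N.
Proof.
move=> sk; rewrite orthoproj_colker//; set P := _ - _.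
have [e1 _ _ e4] := moore_penroseP k; rewrite /colker sk trmxK.
have defP : (P :=: kermx k)%MS.
  apply/eqmxP/andP; split.
    apply/sub_kermxP; rewrite /P mulmxBl mul1mx -mulmx_moore_penrose_sym//.
    by rewrite e1 subrr.
  apply/submxP; exists (kermx k).
  rewrite /P mulmxBr mulmx1 -mulmx_moore_penrose_sym// mulmxA mulmx_ker mul0mx.
  by rewrite subr0.
by rewrite (eqmxMr _ defP) addnC mxrank_mul_ker.
Qed.

(** The basis [B] is not orthonormal, so the compression has matrix [B H B^T] times the inverse of
    the Gram matrix [B B^T]; its eigenspaces have the dimensions of the kernels of the pencil formed
    by these two matrices. *)
Lemma rank_eigenspace_compression (R : realFieldType) q d (H P : 'M[R]_q)
    (Q : 'M[R]_(d, q)) s :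
  let B := row_base Q in
  (P^T <= Q)%MS -> Q *m P = Q -> H^T = H ->
  \rank (eigenspace (conjmx B (P *m H)^T) s) =
  (\rank Q - \rank (B *m H *m B^T - s *: (B *m B^T))%R)%N.
Proof.
move=> B PQ QP sH; rewrite /eigenspace mxrank_ker.
have uG := row_free_gram (row_base_free Q).
have BP : B *m P = B.
  have /submxP[D BD] : (B <= Q)%MS by rewrite eq_row_base.
  by rewrite BD -mulmxA QP.
(* The rows of [(P *m H)^T] lie in [Q], where [pinvmx B *m B] acts as the identity. *)
have PB : (P *m H)^T = (P *m H)^T *m pinvmx B *m B.
  rewrite mulmxKpV// eq_row_base trmx_mul; exact: submx_trans (submxMl _ _) PQ.
suff <- : (conjmx B (P *m H)^T - s%:M) *m (B *m B^T) =
    B *m H *m B^T - s *: (B *m B^T) by rewrite mxrankMfree// row_free_unit.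
rewrite mulmxBl mul_scalar_mx /conjmx; congr (_ - _).
transitivity (B *m ((P *m H)^T *m pinvmx B *m B) *m B^T).
  by rewrite !mulmxA.
by rewrite -PB trmx_mul sH -!mulmxA -trmx_mul BP.
Qed.

(** The inertia of [A - lam M] is computed from the full pencil and from its block reduction.
    Comparing negative indices gives the first formula, comparing ranks the second. *)
Lemma spectral_difference (R : realType) nI nB (A M : 'M[R]_(nI + nB)) lam :
  A^T = A -> posdef M ->
  (N_N A M lam)%:Z - (N_D A M lam)%:Z
    = (n_neg (DtN A M lam))%:Z + (m_D A M lam)%:Z - (m_in A M lam)%:Z
  /\ m_N A M lam = (n_zero (DtN A M lam) + m_in A M lam)%N.
Proof.
move=> sA pM; have [sM M_gt0] := pM.
have iN := has_inertia_counting lam sA pM.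
have sAI : (ulsubmx A)^T = ulsubmx A by rewrite trmx_ulsub sA.
have pMI : posdef (ulsubmx M).
  have -> : ulsubmx M =
      row_mx 1%:M 0 *m M *m (row_mx 1%:M 0 : 'M[R]_(nI, nI + nB))^T.
    rewrite -[in RHS](submxK M) tr_row_mx trmx1 trmx0 mul_row_block mul_row_col.
    by rewrite !mul1mx !mul0mx !addr0 mulmx1 mulmx0 addr0.
  apply: posdef_congr => //; apply/row_freeP; exists (col_mx 1%:M 0).
  by rewrite mul_row_col mulmx1 mul0mx addr0.
have iD := has_inertia_counting lam sAI pMI.
set k := pencil (ulsubmx A) (ulsubmx M) lam in iD.
pose c := ursubmx A - lam *: ursubmx M.
pose l := drsubmx A - lam *: drsubmx M.
have dlE (X : 'M[R]_(nI + nB)) : X^T = X -> dlsubmx X = (ursubmx X)^T.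
  by move=> sX; rewrite trmx_ursub sX.
have trB m n (X Y : 'M[R]_(m, n)) : (X - lam *: Y)^T = X^T - lam *: Y^T.
  by apply/matrixP => i j; rewrite !mxE.
have cT : dlsubmx A - lam *: dlsubmx M = c^T.
  by rewrite trB (dlE _ sA) (dlE _ sM).
have sk : k^T = k by rewrite trB sAI pMI.1.
have sl : l^T = l by rewrite trB !trmx_drsub sA sM.
have KE : pencil A M lam = block_mx k c c^T l.
  by rewrite -cT -[LHS]submxK; congr block_mx;
    apply/matrixP => i j; rewrite !mxE.
pose P := orthoproj (colker k).
set r := \rank (P *m c).
have m_inE : (m_in A M lam + r = m_D A M lam)%N.
  by rewrite /m_in /S_in cT inner_rank.
(* This turns the matrix defining [Q_space] into the Gram matrix of [P *m c]. *)
have PP : P^T *m P = P.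
  have sP : P^T = P.
    have [_ _ _ e4] := moore_penroseP k.
    by rewrite /P orthoproj_colker// raddfB /= trmx1 e4.
  have /submxP[D PD] := orthoproj_tr_sub (colker k).
  by rewrite PD -mulmxA orthoproj_id -PD -/P sP.
have QE : Q_space A M lam = colker ((P *m c)^T *m (P *m c)).
  rewrite /Q_space cT -/c -/k -/P; congr colker.
  by rewrite [in RHS]trmx_mul -[RHS]mulmxA (mulmxA P^T) PP mulmxA.
pose B := row_base (Q_space A M lam).
have defB : (B :=: kermx (P *m c)^T)%MS.
  apply: (eqmx_trans (eq_row_base _)).
  by rewrite QE; apply: kermx_gram.
pose H := DtN_hat A M lam.
have HE : H = l - c^T *m moore_penrose k *m c by rewrite /H /DtN_hat cT.
have sH : H^T = H.
  by rewrite HE schur_sym.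
(* The spectrum of [DtN] becomes that of a symmetric-definite pencil, to which
   [has_inertia_counting] applies at 0. *)
have DtN_mult s : \rank (eigenspace (DtN A M lam) s) =
    mult (B *m H *m B^T) (B *m B^T) s.
  rewrite mult_rank /DtN rank_eigenspace_compression//.
    exact: orthoproj_tr_sub.
  exact: orthoproj_id.
have sS : (B *m H *m B^T)^T = B *m H *m B^T by exact: sym_congr.
have pG : posdef (B *m B^T).
  rewrite -[B in B *m _]mulmx1; apply: posdef_congr; first exact: row_base_free.
  split=> [|u u0]; first exact: trmx1.
  rewrite /qform mulmx1 lt0r; apply/andP; split; last first.
    by rewrite mxE sumr_ge0// => i _; rewrite mxE -expr2 sqr_ge0.
  apply: contraNneq u0 => e; apply/eqP/mulmx_tr_eq0/matrixP => i j.
  by rewrite !ord1 e mxE.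
have iL := has_inertia_counting 0 sS pG.
have n_negE : n_neg (DtN A M lam) = Defs.counting (B *m H *m B^T) (B *m B^T) 0.
  by apply: eq_fsbigr => s _.
have n_zeroE : n_zero (DtN A M lam) = mult (B *m H *m B^T) (B *m B^T) 0.
  exact: DtN_mult.
rewrite /pencil scale0r subr0 HE in iL.
have := has_inertia_schur sk sl iD defB iL.
rewrite -KE -HE => iK.
have e1 := has_inertia_uniq iN iK.
have e2 : (nI + nB - mult A M lam)%N = _ := etrans (esym iN.1) iK.1.
have rQ : (\rank (Q_space A M lam) + r = nB)%N.
  rewrite -(eq_row_base (Q_space A M lam)) -/B defB mxrank_ker mxrank_tr.
  by rewrite subnK// rank_leq_col.
have le_mult n (X Y : 'M[R]_n) t : (mult X Y t <= n)%N by exact: rank_leq_row.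
have hN := le_mult _ A M lam; have hD := le_mult _ (ulsubmx A) (ulsubmx M) lam.
have hL := le_mult _ (B *m H *m B^T) (B *m B^T) 0.
rewrite n_negE n_zeroE /N_N /N_D /m_N; move: m_inE; rewrite /m_D.
(* What remains is linear arithmetic; the bounds [hN], [hD], [hL] control the truncated
   subtractions. *)
move: (mult A M lam) (mult _ _ lam) (mult _ _ 0) (Defs.counting A M lam)
  (Defs.counting _ _ lam) (Defs.counting _ _ 0) (m_in A M lam) hN hD hL e1 e2.
rewrite -/P -/r; move: r (\rank _) rQ => r' q rQ.
clear -rQ; move: rQ => rQ a b d x y z m hN hD hL e1 e2 e3; split; lia.
Qed.

(** * Positive definiteness of the mass matrix *)

Definition box (R : realType) (a b : plane R) : set (plane R) :=
  `]a.1, b.1[%classic `*` `]a.2, b.2[%classic.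

Lemma measurable_box (R : realType) (a b : plane R) : measurable (box a b).
Proof. by apply: measurableX; exact: measurable_itv. Qed.

Lemma open_box_nbhs (R : realType) (U : set (plane R)) (z : plane R) :
  open U -> U z -> exists e : {posnum R},
    box (z.1 - e%:num, z.2 - e%:num) (z.1 + e%:num, z.2 + e%:num) `<=` U.
Proof.
move=> oU Uz; have /nbhs_ballP[e /= e0 zeU] : nbhs z U by exact: open_nbhs_nbhs.
exists (PosNum e0) => y -[/=]; rewrite !in_itv /= => /andP[a b] /andP[c d].
apply: zeU; split=> /=; rewrite /ball /= ltr_norml; apply/andP; split; lra.
Qed.

(** An open set is the union of the rational boxes inside it, which are countably many; the other
    boxes are replaced by the empty set. *)
Lemma open_measurable_plane (R : realType) (U : set (plane R)) :
  open U -> measurable U.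
Proof.
move=> oU.
pose B (q : (rat * rat) * (rat * rat)) : set (plane R) :=
  box (ratr q.1.1, ratr q.1.2) (ratr q.2.1, ratr q.2.2).
have -> : U = \bigcup_q (if `[< B q `<=` U >] then B q else set0).
  apply/seteqP; split => [z Uz|z [q _]]; last by case: asboolP => // h /h.
  have [e eU] := open_box_nbhs oU Uz; have e0 : 0 < e%:num by [].
  have [a1 ] := @rat_in_itvoo _ (z.1 - e%:num) z.1 ltac:(lra).
  have [b1 ] := @rat_in_itvoo _ z.1 (z.1 + e%:num) ltac:(lra).
  have [a2 ] := @rat_in_itvoo _ (z.2 - e%:num) z.2 ltac:(lra).
  have [b2 ] := @rat_in_itvoo _ z.2 (z.2 + e%:num) ltac:(lra).
  rewrite !in_itv /= => /andP[? ?] /andP[? ?] /andP[? ?] /andP[? ?].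
  exists ((a1, a2), (b1, b2)) => //.
  have -> : `[< B (a1, a2, (b1, b2)) `<=` U >].
    apply/asboolP; apply: subset_trans eU => y [/=]; rewrite !in_itv /=.
    move=> /andP[? ?] /andP[? ?].
    by split; rewrite /= in_itv /=; apply/andP; split; lra.
  by split; rewrite /= in_itv /=; apply/andP; split; lra.
apply: countable_bigcupT_measurable => [|q]; first exact: countableP.
by case: ifP => // _; exact: measurable_box.
Qed.

Lemma within_continuous_measurable_plane (R : realType) (U : set (plane R))
    (f : plane R -> R) :
  open U -> {within U, continuous f} -> measurable_fun U f.
Proof.
move=> oU; rewrite continuous_open_subspace// => cf.
apply: (measurability _ (measurable_realfun.RGenOpens.measurableE R)).
move=> _ [_ [a [b ->] <-]]; apply: open_measurable_plane.
rewrite openE => z [Uz fz]; rewrite /interior; apply: filterI.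
  exact: open_nbhs_nbhs.
apply: (cf z (mem_set Uz)); apply: open_nbhs_nbhs; split => //.
Qed.

Lemma bounded_set_box (R : realType) (A : set (plane R)) :
  bounded_set A -> exists N : R, A `<=` `[- N, N]%classic `*` `[- N, N]%classic.
Proof.
move=> [N [_ hN]]; exists (N + 1) => z /(hN (N + 1) ltac:(lra)).
rewrite /= prod_normE ge_max => /andP[]; rewrite !ler_norml => h1 h2.
by split; rewrite /= in_itv.
Qed.

Lemma bounded_area_fin (R : realType) (A : set (plane R)) :
  measurable A -> bounded_set A -> (area R A < +oo)%E.
Proof.
move=> mA /bounded_set_box[N AN].
apply: (@le_lt_trans _ _ (area R (`[- N, N]%classic `*` `[- N, N]%classic))).
  apply: le_measure; rewrite ?inE//; apply: measurableX; exact: measurable_itv.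
rewrite product_measure1E//=.
rewrite lebesgue_measure_itv/=; case: ifP => _; rewrite ?mule0 ?mul0e//.
by rewrite -EFinB -EFinM ltry.
Qed.

Lemma bounded_closure_compact (R : realType) (A : set (plane R)) :
  bounded_set A -> compact (closure A).
Proof.
move=> /bounded_set_box[N AN].
have cB : compact (`[- N, N]%classic `*` `[- N, N]%classic : set (plane R)).
  by apply: compact_setX; exact: segment_compact.
apply: (subclosed_compact _ cB); first exact: closed_closure.
have /closure_id -> :
    closed (`[- N, N]%classic `*` `[- N, N]%classic : set (plane R)).
  exact: compact_closed.
exact: closureS.
Qed.

Lemma box_area_gt0 (R : realType) (a b : plane R) :
  a.1 < b.1 -> a.2 < b.2 -> (0 < area R (box a b))%E.
Proof.
move=> h1 h2; rewrite product_measure1E//=; do ?exact: measurable_itv.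
rewrite !lebesgue_measure_itv/= !lte_fin h1 h2.
by rewrite mule_gt0// -EFinB lte_fin subr_gt0.
Qed.

(** * Integrals of continuous functions over the domain *)

Lemma within_continuousM (R : realType) (T : topologicalType) (A : set T)
    (f g : T -> R) :
  {within A, continuous f} -> {within A, continuous g} ->
  {within A, continuous (fun z => f z * g z)}.
Proof.
move=> /subspace_continuousP cf /subspace_continuousP cg.
by apply/subspace_continuousP => z Az; apply: cvgM; [exact: cf|exact: cg].
Qed.

Lemma within_continuous_lincomb (R : realType) (T : topologicalType)
    (A : set T) (I : Type) (s : seq I) (c : I -> R) (f : I -> T -> R) :
  (forall i, {within A, continuous (f i)}) ->
  {within A, continuous (fun z => \sum_(i <- s) c i * f i z)}.
Proof.
move=> cf; apply/subspace_continuousP => z Az /=; elim: s => [|i s IHs].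
  rewrite (_ : (fun=> _) = cst 0); first exact: cvg_cst.
  by apply/funext => y; rewrite big_nil.
rewrite (_ : (fun=> _) = (fun y => c i * f i y + \sum_(i <- s) c i * f i y)).
  by apply: cvgD IHs; apply: cvgMr; have /subspace_continuousP := cf i; exact.
by apply/funext => y; rewrite big_cons.
Qed.

(** Continuity up to the compact closure bounds [f], and [Omega] has finite area. *)
Lemma within_continuous_integrable_plane (R : realType) (Omega : set (plane R))
    (f : plane R -> R) :
  open Omega -> bounded_set Omega -> {within closure Omega, continuous f} ->
  (area R).-integrable Omega (EFin \o f).
Proof.
move=> oO bO cf; have mO := open_measurable_plane oO.
apply: measurable_bounded_integrable => //; first exact: bounded_area_fin.
  apply: within_continuous_measurable_plane => //.
  by apply: continuous_subspaceW cf; exact: subset_closure.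
have /compact_bounded[N [Nr hN]] :=
  continuous_compact cf (bounded_closure_compact bO).
exists N; split => // r Nr' z Oz; apply: (hN r Nr'); exists z => //.
exact: subset_closure.
Qed.

Lemma Rintegral_sum d (T : measurableType d) (R : realType)
    (mu : {measure set T -> \bar R}) (D : set T) (I : Type) (s : seq I)
    (f : I -> T -> R) : measurable D ->
  (forall i, mu.-integrable D (EFin \o f i)) ->
  \int[mu]_(z in D) (\sum_(i <- s) f i z) =
  \sum_(i <- s) \int[mu]_(z in D) f i z.
Proof.
move=> mD intf; elim: s => [|i s IHs].
  rewrite big_nil; under eq_Rintegral do rewrite big_nil.
  by rewrite Rintegral_cst// mul0r.
rewrite big_cons -IHs -RintegralD//.
  by apply: eq_Rintegral => z _; rewrite big_cons.
rewrite (_ : EFin \o _ = fun z => (\sum_(i <- s) (f i z)%:E)%E).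
  by apply: integrable_sum => // j _; exact: intf.
by apply/funext => z; rewrite /= sumEFin.
Qed.

(** The square of [f] exceeds half of its value at [z] on some box inside [Omega], and boxes have
    positive area. *)
Lemma Rintegral_sqr_gt0 (R : realType) (Omega : set (plane R))
    (f : plane R -> R) (z : plane R) :
  open Omega -> bounded_set Omega -> {within closure Omega, continuous f} ->
  closure Omega z -> f z != 0 ->
  0 < \int[area R]_(y in Omega) (f y * f y).
Proof.
move=> oO bO cf Oz fz; have mO := open_measurable_plane oO.
have cff := within_continuousM cf cf.
have iff := within_continuous_integrable_plane oO bO cff.
pose c := (f z * f z) / 2.
have c0 : 0 < c by rewrite divr_gt0// -expr2 exprn_even_gt0.
(* [z] may be a boundary point; by continuity up to the closure a nearby point of [Omega] serves
   instead. *)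
have [y [Oy cy]] : exists y, Omega y /\ c < f y * f y.
  have /subspace_continuousP/(_ z Oz) := cff.
  move=> /(_ [set t | c < t]) h.
  have /h : nbhs (f z * f z) [set t | c < t].
    apply: open_nbhs_nbhs; split; first exact: open_gt.
    by move: c0; rewrite /= /c; lra.
  rewrite /= /within /= => /Oz [y [Oy hy]].
  by exists y; split => //; apply: hy; exact: subset_closure.
have [a [b [ab1 ab2 abO]]] : exists a b : plane R, [/\ a.1 < b.1, a.2 < b.2 &
    box a b `<=` Omega `&` [set t | c < f t * f t]].
  have oW : open (Omega `&` [set t | c < f t * f t]).
    have := continuous_subspaceW (@subset_closure _ Omega) cff.
    rewrite continuous_open_subspace// => cO.
    rewrite openE => t [Ot ct]; apply: filterI; first exact: open_nbhs_nbhs.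
    apply: (cO t (mem_set Ot) [set r | c < r]).
    by apply: open_nbhs_nbhs; split => //; exact: open_gt.
  have [e eW] := open_box_nbhs oW (conj Oy cy).
  have e0 : 0 < e%:num by [].
  by eexists; eexists; split; last exact: eW; rewrite /=; lra.
have boxO : box a b `<=` Omega by move=> t /abO[].
have mB := measurable_box a b.
have boxfin : (area R (box a b) < +oo)%E.
  apply: le_lt_trans (bounded_area_fin mO bO).
  by apply: le_measure; rewrite ?inE.
have ifB : (area R).-integrable (box a b) (EFin \o (fun y => f y * f y)).
  exact: integrableS iff.
apply: (@lt_le_trans _ _ (c * fine (area R (box a b)))).
  rewrite mulr_gt0// fine_gt0// box_area_gt0//=.
rewrite -Rintegral_cst//.
apply: (@le_trans _ _ (\int[area R]_(y in box a b) (f y * f y))).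
  apply: le_Rintegral => // [|t /abO[_ /ltW]//].
  apply: measurable_bounded_integrable => //; exact: bounded_cst.
rewrite /Rintegral fine_le ?integrable_fin_num//.
apply: ge0_subset_integral => //; first by case/integrableP : iff.
by move=> t _; rewrite lee_fin -expr2 sqr_ge0.
Qed.

(** The quadratic form at [u] is the integral of the square of [F], the combination of the [phi i]
    with coefficients [u 0 i], and [F] takes the value [u 0 j] at [x j]. *)
Lemma posdef_mass_mx (R : realType) (Omega : set (plane R)) n
    (x : 'I_n -> plane R) (phi : 'I_n -> plane R -> R) :
  open Omega -> bounded_set Omega -> continuous_nodal Omega x phi ->
  (forall j, closure Omega (x j)) -> posdef (mass_mx Omega phi).
Proof.
move=> oO bO [cphi phix] Ox; have mO := open_measurable_plane oO.
split=> [|u u0].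
  apply/matrixP => i j; rewrite !mxE; apply: eq_Rintegral => z _.
  exact: mulrC.
pose F z := \sum_i u 0 i * phi i z.
have cF : {within closure Omega, continuous F}.
  exact: within_continuous_lincomb.
suff -> : qform (mass_mx Omega phi) u = \int[area R]_(z in Omega) (F z * F z).
  have [j uj] : exists j, u 0 j != 0.
    apply/existsP; apply: contraNT u0 => /existsPn h; apply/eqP/rowP => i.
    by rewrite mxE; apply/eqP; rewrite -[_ == _]negbK h.
  apply: (@Rintegral_sqr_gt0 _ _ _ (x j)) => //.
  rewrite /F (bigD1 j)//= big1 ?addr0 => [|i ij]; rewrite phix ?eqxx ?mulr1//.
  by rewrite (negPf ij) mulr0.
(* Expanding the square over pairs of indices lets the integral pass through a single finite sum. *)
pose g (p : 'I_n * 'I_n) z := (u 0 p.1 * u 0 p.2) * (phi p.2 z * phi p.1 z).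
have ip p : (area R).-integrable Omega
    (EFin \o (fun z => phi p.2 z * phi p.1 z)).
  by apply: within_continuous_integrable_plane => //; exact: within_continuousM.
transitivity (\int[area R]_(z in Omega) (\sum_p g p z)); last first.
  apply: eq_Rintegral => z _.
  rewrite /F mulr_suml -(pair_bigA _ (fun i j => g (i, j) z)).
  apply: eq_bigr => i _; rewrite mulr_sumr; apply: eq_bigr => j _.
  by rewrite /g /=; ring.
rewrite Rintegral_sum// => [|p]; last first.
  rewrite (_ : EFin \o g p = fun z =>
      ((u 0 p.1 * u 0 p.2)%:E * (phi p.2 z * phi p.1 z)%:E)%E).
    by apply: integrableZl => //; exact: ip.
  by apply/funext => z.
rewrite /qform mxE.
rewrite -(pair_bigA _ (fun i j => \int[area R]_(z in Omega) g (i, j) z)).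
rewrite exchange_big.
apply: eq_bigr => j _; rewrite !mxE mulr_suml; apply: eq_bigr => i _.
rewrite /g /= RintegralZl//; last exact: (ip (i, j)).
by rewrite !mxE /=; ring.
Qed.

(** * Application to the finite element matrices *)

Lemma mesh_nodes_closure (R : realType) (Omega : set (plane R)) (p m : nat)
    (T : 'I_m -> 'I_p -> plane R) (nI nB : nat)
    (x : 'I_(nI + nB) -> plane R) j :
  conforming_mesh Omega T -> mesh_nodes Omega T x -> closure Omega (x j).
Proof.
move=> [_ -> _] [_ xT _ _].
have [k [i ->]] : [set z | exists k i, z = T k i] (x j).
  by rewrite -xT; exists j.
(* A vertex is the convex combination with Kronecker weights. *)
exists k => //; exists (fun i' => (i' == i)%:R); split.
- by move=> i'; exact: ler0n.
- by rewrite (bigD1 i)//= eqxx big1 ?addr0// => i' /negPf->.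
- rewrite (bigD1 i)//= eqxx scale1r big1 ?addr0// => i' /negPf->.
  by rewrite scale0r.
Qed.

Theorem theorem5p1 (R : realType) (Omega : set (plane R)) (nI nB : nat)
    (x : 'I_(nI + nB) -> plane R) (phi : 'I_(nI + nB) -> plane R -> R)
    (A M : 'M[R]_(nI + nB)) (lam : R) :
  polygonal_domain Omega ->
  P1_discretization Omega x phi \/ Q1_discretization Omega x phi ->
  A = stiffness_mx Omega phi ->
  M = mass_mx Omega phi ->
  (N_N A M lam)%:Z - (N_D A M lam)%:Z
    = (n_neg (DtN A M lam))%:Z + (m_D A M lam)%:Z - (m_in A M lam)%:Z
  /\ m_N A M lam = (n_zero (DtN A M lam) + m_in A M lam)%N.
Proof.
move=> [oO _ _ bO _] discr -> ->; apply: spectral_difference.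
  (* The stiffness matrix is symmetric because its integrand is, pointwise. *)
  apply/matrixP => i j; rewrite !mxE; apply: eq_Rintegral => z _.
  by rewrite /grad_dot; congr (_ + _); exact: mulrC.
have [cphi Ox] : continuous_nodal Omega x phi /\ forall j, closure Omega (x j).
  by case: discr => -[m [T [mesh nodes cphi _]]]; split => // j;
    exact: mesh_nodes_closure mesh nodes.
exact: posdef_mass_mx cphi Ox.
Qed.
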